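(* Let $n\ge 5$ be an odd integer, let $K$ be either $\mathbb{Q}$ or $\mathbb{C}$, and let $a,b\ge 1$ be integers. An $a\times b$ rectangle in the square lattice can be signed tiled by $\mathcal{T}_n$ with weights in $K$ (in place of the integral weights $\pm1$) if and only if at least one of $a,b$ is divisible by $n$.
   Context: Work in the square lattice; a cell is a unit square, identified with the integer coordinates $(\alpha,\beta)\in\mathbb{Z}^2$ of its lower left corner. $\mathcal{T}_n=\{T_1,T_2,T_3,T_4\}$ is the set of ribbon $L$-shaped $n$-ominoes, where, as sets of $n$ cells, $T_1=\{(0,j):0\le j\le n-2\}\cup\{(1,0)\}$, $T_2=\{(1,j):0\le j\le n-2\}\cup\{(0,n-2)\}$, $T_3=\{(i,0):0\le i\le n-2\}\cup\{(0,1)\}$, $T_4=\{(i,1):0\le i\le n-2\}\cup\{(n-2,0)\}$. Only translates of the tiles by integer vectors are allowed. A signed tiling of a region $R$ (a set of cells) by $\mathcal{T}_n$ with weights in $K$ is a finite collection of translates of tiles of $\mathcal{T}_n$, each assigned a weight in $K$, such that for every cell in $R$ the sum of the weights of the tiles covering it is $1$, and for every cell outside $R$ this sum is $0$. An $a\times b$ rectangle has height $a$ and base $b$ and consists of $ab$ cells. *)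

(* Defs.v *)
From mathcomp Require Import all_boot all_order all_algebra.
From mathcomp Require Import complex reals.

Set Implicit Arguments.
Unset Strict Implicit.
Unset Printing Implicit Defensive.

Import Order.TTheory GRing.Theory Num.Theory.
Local Open Scope ring_scope.

(* A unit square is identified with the coordinates of its lower left corner. *)
Definition cell : Type := (int * int)%type.

Variant shape := T1 | T2 | T3 | T4.

(* The ribbon L-shaped n-ominoes. The subtraction [n%:Z - 2] is on integers,
   hence not truncated. *)
Definition tile (n : nat) (T : shape) : {pred cell} :=
  match T with
  | T1 => [pred c : cell |
            (c.1 == 0) && (0 <= c.2 <= n%:Z - 2) || (c == (1, 0))]
  | T2 => [pred c : cell |
            (c.1 == 1) && (0 <= c.2 <= n%:Z - 2) || (c == (0, n%:Z - 2))]
  | T3 => [pred c : cell |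
            (c.2 == 0) && (0 <= c.1 <= n%:Z - 2) || (c == (0, 1))]
  | T4 => [pred c : cell |
            (c.2 == 1) && (0 <= c.1 <= n%:Z - 2) || (c == (n%:Z - 2, 0))]
  end.

Record weighted_tile (K : nzRingType) := WeightedTile {
  tile_shape : shape;
  tile_shift : cell;
  tile_weight : K
}.

Definition covers (K : nzRingType) (n : nat) (t : weighted_tile K) (c : cell) :
  bool := c - tile_shift t \in tile n (tile_shape t).

(* The collection is a list: a translate may occur in it several times, in
   which case its weights add up. *)
Definition signed_tiling (K : nzRingType) (n : nat) (A : {pred cell})
    (s : seq (weighted_tile K)) : Prop :=
  forall c : cell,
    \sum_(t <- s | covers n t c) tile_weight t = if c \in A then 1 else 0.

Definition signed_tileable (K : nzRingType) (n : nat) (A : {pred cell}) : Prop :=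
  exists s : seq (weighted_tile K), signed_tiling n A s.

(* The rectangle of height a and base b with lower left corner p. *)
Definition rectangle (p : cell) (a b : nat) : {pred cell} :=
  [pred c : cell | (p.1 <= c.1 < p.1 + b%:Z) && (p.2 <= c.2 < p.2 + a%:Z)].

(* Main.v *)
Require Import Defs.
From mathcomp Require Import all_boot all_order all_algebra.
From mathcomp Require Import complex reals.
From mathcomp Require Import cyclic separable cyclotomic zify ring.

Set Implicit Arguments.
Unset Strict Implicit.
Unset Printing Implicit Defensive.

Import Order.TTheory GRing.Theory Num.Theory.
Local Open Scope ring_scope.

(* Encode the cell (i, j) as the monomial x^i y^j. If n is odd, the ideal of
   Z[x, y] generated by the four tiles contains xy - 1, hence also the bars
   1 + x + ... + x^(n-1) and 1 + y + ... + y^(n-1); this tiles every rectangle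
   with a side divisible by n, with integral weights. Conversely, if z is a
   primitive n-th root of unity, the point (z^-1, z) is a common zero of the
   tiles, so that a tileable rectangle satisfies
   (1 + z^-1 + ... + z^-(b-1)) (1 + z + ... + z^(a-1)) = 0. *)

(** * Roots of unity and geometric sums *)

(** As [n] is nonzero in [F], the polynomial X^n - 1 is separable: it has n distinct roots, and one
    of them has order n. *)
Lemma closed_field_prim_root_exists (F : closedFieldType) n :
  n%:R != 0 :> F -> exists z : F, n.-primitive_root z.
Proof.
move=> nF; have n_gt0 : (0 < n)%N by case: n nF => //; rewrite eqxx.
have [r] := closed_field_poly_normal ('X^n - 1 : {poly F}).
rewrite (monicP (monicXnsubC 1 n_gt0)) scale1r => Dr.
suff /hasP[z _ zP] : has n.-primitive_root r by exists z.
apply: has_prim_root => //.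
- by apply/allP => z; rewrite -root_prod_XsubC -Dr.
- by rewrite -separable_prod_XsubC -Dr separable_Xn_sub_1.
- by rewrite -ltnS -(size_prod_XsubC r id) -Dr size_XnsubC.
Qed.

Definition geom (A : nzSemiRingType) (x : A) (m : nat) : A := \sum_(i < m) x ^+ i.

Lemma geom_iota (A : nzSemiRingType) (x : A) m :
  geom x m = \sum_(i <- iota 0 m) x ^+ i.
Proof. by rewrite -[in RHS](subn0 m) [RHS](big_mkord xpredT). Qed.

Lemma geomS (A : nzSemiRingType) (x : A) m : geom x m.+1 = geom x m + x ^+ m.
Proof. exact: big_ord_recr. Qed.

Lemma geomD (A : nzSemiRingType) (x : A) m k :
  geom x (m + k) = geom x m + x ^+ m * geom x k.
Proof.
rewrite /geom big_split_ord /= mulr_sumr; congr (_ + _).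
by apply: eq_bigr => i _; rewrite exprD.
Qed.

(** Cuts the sum into [k] blocks of [m] terms; hence a bar of length [n * k] is a multiple of the
    bar of length [n]. *)
Lemma geomM (A : comNzRingType) (x : A) m k :
  geom x (m * k) = geom x m * geom (x ^+ m) k.
Proof.
elim: k => [|k IH]; first by rewrite muln0 /geom !big_ord0 mulr0.
by rewrite mulnS addnC geomD IH geomS mulrDr -exprM [X in _ + X]mulrC.
Qed.

Lemma geom_even (A : comNzRingType) (x : A) k :
  geom x k.*2 = (1 + x) * geom (x ^+ 2) k.
Proof.
by rewrite -mul2n geomM; congr (_ * _); rewrite /geom !big_ord_recl big_ord0 addr0.
Qed.

(** * The ideal generated by the tiles *)

Section Ideal.
Variables (A : comNzRingType) (x y : A) (n : nat).

Definition tile_poly (T : Defs.shape) : A :=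
  match T with
  | T1 => geom y n.-1 + x
  | T2 => x * geom y n.-1 + y ^+ n.-2
  | T3 => geom x n.-1 + y
  | T4 => y * geom x n.-1 + x ^+ n.-2
  end.

(** An ideal given only by its closure properties, so that [tiled] below can take its place. *)
Variable I : A -> Prop.
Hypothesis ID : forall P Q, I P -> I Q -> I (P + Q).
Hypothesis IM : forall P Q, I Q -> I (P * Q).
Hypothesis IT : forall T, I (tile_poly T).
Hypotheses (n_gt1 : (1 < n)%N) (n_odd : odd n).

(* Write [e = xy - 1]. As [(1 + x) e = (y - 1 + xy) T1 - y T2], and
   symmetrically for [y], we have [x e = y e = -e] modulo the tiles. As [n] is
   odd, [geom (-1) n.-1 = 0], so that [0 = T1 e = -e]. *)
Lemma ideal_xy_sub1 : I (x * y - 1).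
Proof.
set k := n.-1./2; have Dn : n.-1 = k.*2 by rewrite /k; lia.
have geomX (z : A) : (z - 1) * geom z n.-1 = z * z ^+ n.-2 - 1.
  rewrite -exprS; have -> : n.-2.+1 = n.-1 by lia.
  by rewrite /geom -subrX1.
have gy := geomX y; have gx := geomX x.
(* The first two terms add up to (1 - a) e, where a = [geom y n.-1]. The last bracket is (1 + y) e,
   and a = (1 + y) [geom (y ^+ 2) k], so the last term restores a e. *)
have -> : x * y - 1 =
    y * tile_poly T1 + (- y) * tile_poly T2
    + geom (y ^+ 2) k *
      ((x - 1 + x * y) * tile_poly T3 + (- x) * tile_poly T4).
  have gk : geom y n.-1 = (1 + y) * geom (y ^+ 2) k by rewrite Dn geom_even.
  rewrite /tile_poly /=.
  move: gy gx gk.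
  move: (geom y _) (geom x _) (geom (y ^+ 2) k) (y ^+ n.-2) (x ^+ n.-2).
  move=> a b c d e gy gx gk.
  have {}gy : y * d = (y - 1) * a + 1 by rewrite gy subrK.
  have {}gx : x * e = (x - 1) * b + 1 by rewrite gx subrK.
  ring: gy gx gk.
by do ?[exact: IT | apply: ID | apply: IM].
Qed.

(** Multiplication by y moves the column of T1 up by one cell and its lone cell to xy; trading xy
    for 1 fills the gap at the bottom. *)
Lemma ideal_geom_y : I (geom y n).
Proof.
have -> : geom y n = y * tile_poly T1 + (-1) * (x * y - 1).
  rewrite /= -[in LHS](prednK (n := n)); last by lia.
  rewrite -add1n geomD {1}/geom big_ord1; ring.
by apply: ID; apply: IM; [exact: IT | exact: ideal_xy_sub1].
Qed.

Lemma ideal_geom_x : I (geom x n).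
Proof.
have -> : geom x n = x * tile_poly T3 + (-1) * (x * y - 1).
  rewrite /= -[in LHS](prednK (n := n)); last by lia.
  rewrite -add1n geomD {1}/geom big_ord1; ring.
by apply: ID; apply: IM; [exact: IT | exact: ideal_xy_sub1].
Qed.

Lemma ideal_rectangle a b : (n %| a)%N || (n %| b)%N -> I (geom x b * geom y a).
Proof.
case/orP => /dvdnP[k ->]; rewrite mulnC geomM.
  by rewrite mulrCA mulrC; apply: IM; exact: ideal_geom_y.
by rewrite -mulrA mulrC; apply: IM; exact: ideal_geom_x.
Qed.

End Ideal.

(** * From polynomials to signed tilings *)

Section Tiling.
Variables (K : comNzRingType) (n : nat).
Implicit Types (s : seq (weighted_tile K)) (c d p : cell).

Definition total_weight s c : K :=
  \sum_(t <- s | covers n t c) tile_weight t.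

Definition scale_tiling k s :=
  [seq WeightedTile (tile_shape t) (tile_shift t) (k * tile_weight t) | t <- s].

Lemma total_weight_scale k s c :
  total_weight (scale_tiling k s) c = k * total_weight s c.
Proof. by rewrite /total_weight big_map mulr_sumr. Qed.

Definition shift_tiling d s :=
  [seq WeightedTile (tile_shape t) (tile_shift t + d) (tile_weight t) | t <- s].

Lemma total_weight_shift d s c :
  total_weight (shift_tiling d s) c = total_weight s (c - d).
Proof.
rewrite /total_weight big_map; apply: eq_bigl => t.
by rewrite /covers /= opprD addrA addrAC.
Qed.

Lemma total_weight_cat s1 s2 c :
  total_weight (s1 ++ s2) c = total_weight s1 c + total_weight s2 c.
Proof. by rewrite /total_weight big_cat. Qed.

(* The polynomial [P] in ['X] (abscissa) and ['X%:P] (ordinate), read as a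
   weighting of the cells. *)
Definition cell_coef (P : {poly {poly K}}) (c : cell) : K :=
  match c with
  | (Posz i, Posz j) => P`_i`_j
  | _ => 0
  end.

Definition tiled (P : {poly {poly K}}) : Prop :=
  exists s, forall c, total_weight s c = cell_coef P c.

Lemma tiledD P Q : tiled P -> tiled Q -> tiled (P + Q).
Proof.
move=> [s sP] [t tQ]; exists (s ++ t) => c.
rewrite total_weight_cat sP tQ.
by case: c => [[i|i] [j|j]] /=; rewrite ?coefD ?addr0.
Qed.

Lemma tiledZ k P : tiled P -> tiled (k%:P%:P * P).
Proof.
move=> [s sP]; exists (scale_tiling k s) => c.
rewrite total_weight_scale sP.
by case: c => [[i|i] [j|j]] /=; rewrite ?coefCM ?mulr0.
Qed.

Lemma tiledMX P : tiled P -> tiled ('X * P).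
Proof.
move=> [s sP]; exists (shift_tiling (1, 0) s) => c.
rewrite total_weight_shift sP.
case: c => [[[|i]|i] [j|j]] //=; rewrite ?subr0 ?coefXM /= ?coef0 //.
by rewrite subn1 addn0.
Qed.

Lemma tiledMY P : tiled P -> tiled ('X%:P * P).
Proof.
move=> [s sP]; exists (shift_tiling (0, 1) s) => c.
rewrite total_weight_shift sP.
case: c => [[i|i] [[|j]|j]] //=; rewrite ?subr0 ?coefCM ?coefXM /= ?coef0 //.
by rewrite subn1 addn0.
Qed.

(** Constants and the two variables generate the ring: induction on [Q] in the abscissa, then on its
    coefficients in the ordinate. *)
Lemma tiledM Q P : tiled P -> tiled (Q * P).
Proof.
move=> tP; elim/poly_ind: Q => [|Q q IH].
  by rewrite -2!polyC0; apply: tiledZ.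
rewrite mulrDl mulrAC mulrC; apply: tiledD; first exact: tiledMX.
elim/poly_ind: q => [|q k IHq].
  by rewrite -polyC0; apply: tiledZ.
rewrite polyCD polyCM mulrDl; apply: tiledD; last exact: tiledZ.
by rewrite mulrAC mulrC; apply: tiledMY.
Qed.

Lemma geomX (A : nzSemiRingType) m : geom ('X : {poly A}) m = \poly_(i < m) 1.
Proof. by rewrite poly_def; apply: eq_bigr => i _; rewrite scale1r. Qed.

Lemma geomC (A : nzSemiRingType) (q : A) m : geom q%:P m = (geom q m)%:P.
Proof. by rewrite rmorph_sum; apply: eq_bigr => i _; rewrite rmorphXn. Qed.

Hypothesis n_gt1 : (1 < n)%N.

Lemma cell_coef_tile T c :
  cell_coef (tile_poly 'X 'X%:P n T) c = (c \in tile n T)%:R.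
Proof.
case: n n_gt1 => [|[|m]] // _.
have Dm : m.+2%:Z - 2 = m%:Z by lia.
case: T; rewrite /= ?geomC ?geomX; case: c => [[i|i] [j|j]];
  rewrite !inE ?xpair_eqE ?Dm ?andbF //=;
  rewrite ?(coefC, coefD, coefXM, coefCM, coef_poly, coefX, coefXn,
            =^~rmorphXn) /=;
  rewrite ?lez_nat ?eqz_nat ?ltnS.
(* Coordinates 0 and 1 locate the row or column of each tile and its lone cell; the larger ones only
   meet the bound [m]. *)
all: case: i => [|[|i]]; case: j => [|[|j]];
  rewrite //= ?coef_poly ?coefXn ?ltnS ?leq0n.
all: by do ?case: leqP => _; do ?case: eqP => [?|?] //=;
  rewrite ?(mulr1n, mulr0n, coef1, coefC, coefX, coef0) /= ?(addr0, add0r).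
Qed.

Lemma cell_coef_rectangle a b (c : cell) :
  cell_coef (geom 'X b * geom 'X%:P a) c = (c \in rectangle 0 a b)%:R.
Proof.
rewrite geomC !geomX; case: c => [[i|i] [j|j]]; rewrite !inE //= ?andbF //.
rewrite coefMC coef_poly !add0r /= !ltz_nat.
by case: (i < b)%N; rewrite ?mul1r ?mul0r ?coef_poly ?coef0 //; case: ltnP.
Qed.

Hypothesis n_odd : odd n.

Lemma tileable_rectangle a b p :
  (n %| a)%N || (n %| b)%N -> signed_tileable K n (rectangle p a b).
Proof.
move=> dvd_ab.
have tileT T : tiled (tile_poly 'X 'X%:P n T).
  exists [:: WeightedTile T 0 1] => c.
  rewrite cell_coef_tile /total_weight big_mkcond big_seq1 /covers subr0.
  by case: (_ \in _).
(* The polynomial gives the rectangle at the origin; translation by [p] gives the others. *)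
have [s sP] := ideal_rectangle tiledD tiledM tileT n_gt1 n_odd dvd_ab.
exists (shift_tiling p s) => c.
rewrite -/(total_weight _ c) total_weight_shift sP cell_coef_rectangle.
rewrite -[RHS]/(if _ then 1%:R else 0%:R) -(fun_if (fun k : nat => k%:R)).
congr (nat_of_bool _)%:R.
by rewrite !inE /= !add0r !subr_ge0 !ltrBlDl.
Qed.

End Tiling.

(** * Evaluation of tilings at a root of unity *)

(** Serves to pass from rational weights to a field that contains the needed roots of unity. *)
Lemma tileable_map (K L : nzRingType) (f : {rmorphism K -> L}) n A :
  signed_tileable K n A -> signed_tileable L n A.
Proof.
move=> [s sP].
exists [seq WeightedTile (tile_shape t) (tile_shift t) (f (tile_weight t))
       | t <- s] => c.
rewrite big_map -(rmorph_sum f) [X in f X]sP.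
by case: ifP => _; rewrite ?rmorph1 ?rmorph0.
Qed.

Definition tile_cells (n : nat) (T : Defs.shape) : seq cell :=
  match T with
  | T1 => (1, 0) :: [seq (0, j%:Z) | j <- iota 0 n.-1]
  | T2 => (0, n.-2%:Z) :: [seq (1, j%:Z) | j <- iota 0 n.-1]
  | T3 => (0, 1) :: [seq (i%:Z, 0) | i <- iota 0 n.-1]
  | T4 => (n.-2%:Z, 0) :: [seq (i%:Z, 1) | i <- iota 0 n.-1]
  end.

Lemma mem_map_Posz_iota m (z : int) :
  (z \in [seq j%:Z | j <- iota 0 m.+1]) = (0 <= z <= m%:Z).
Proof.
case: z => j; last by apply/negbTE/mapP => -[].
by rewrite mem_map ?mem_iota //; move=> ? ? [].
Qed.

Lemma mem_tile_cells n T : (1 < n)%N -> tile_cells n T =i tile n T.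
Proof.
case: n => [|[|m]] // _ c.
have Dm : m.+2%:Z - 2 = m%:Z by lia.
case: T; rewrite [c \in tile_cells _ _]in_cons [RHS]inE orbC Dm;
  congr (_ || _); rewrite -mem_map_Posz_iota.
all: apply/mapP/andP => [[k kI ->]|[/eqP c1 /mapP[k kI c2]]].
all: try by split; [exact: eqxx | apply/mapP; exists k].
all: by exists k; rewrite // -c1 -c2 -surjective_pairing.
Qed.

Lemma uniq_tile_cells n T : uniq (tile_cells n T).
Proof.
by case: T; rewrite /tile_cells cons_uniq map_inj_uniq ?iota_uniq ?andbT;
  try (by move=> i j []); apply/mapP => -[].
Qed.

(** The inverse is z^(n-1), and n - 1 is coprime to n. *)
Lemma prim_rootV (F : fieldType) n (z : F) :
  n.-primitive_root z -> n.-primitive_root z^-1.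
Proof.
move=> z_prim; have n_gt0 := prim_order_gt0 z_prim.
have -> : z^-1 = z ^+ n.-1.
  have z_neq0 : z != 0 by rewrite (prim_root_eq0 z_prim) -lt0n.
  by apply: (mulfI z_neq0); rewrite divff // -exprS prednK // prim_expr_order.
by rewrite (prim_root_exp_coprime _ z_prim) coprime_sym coprimenP.
Qed.

Lemma geom_prim_root_eq0 (F : fieldType) n (z : F) m :
  (1 < n)%N -> n.-primitive_root z -> (geom z m == 0) = (n %| m)%N.
Proof.
move=> n_gt1 z_prim; have z_neq1 : z - 1 != 0.
  rewrite subr_eq0 -(expr1 z) -(prim_order_dvd z_prim) dvdn1.
  by rewrite neq_ltn n_gt1 orbT.
rewrite (prim_order_dvd z_prim) -[RHS]subr_eq0 subrX1 mulf_eq0.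
by rewrite (negPf z_neq1).
Qed.

Section RootOfUnity.
Variables (F : fieldType) (n : nat) (z : F).
Hypotheses (n_gt1 : (1 < n)%N) (z_prim : n.-primitive_root z).

Let z_neq0 : z != 0.
Proof. by rewrite (prim_root_eq0 z_prim) -lt0n ltnW. Qed.

(** The monomial of the cell at the point (z^-1, z), with an integer exponent to allow negative
    coordinates. *)
Definition cell_value (c : cell) : F := z ^ (c.2 - c.1).

Lemma cell_value_neq0 c : cell_value c != 0.
Proof. exact: expfz_neq0. Qed.

Lemma cell_valueD c d : cell_value (c + d) = cell_value c * cell_value d.
Proof.
rewrite /cell_value -expfzDr //; congr (z ^ _).
by rewrite /= opprD addrACA.
Qed.

Lemma cell_value_nat i j : cell_value (i%:Z, j%:Z) = z^-1 ^+ i * z ^+ j.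
Proof. by rewrite /cell_value addrC expfzDr //= -exprz_inv. Qed.

Lemma sum_tile_cells T : \sum_(c <- tile_cells n T) cell_value c = 0.
Proof.
have zn0 := geom_prim_root_eq0 n n_gt1 z_prim.
have zVn0 := geom_prim_root_eq0 n n_gt1 (prim_rootV z_prim).
rewrite dvdnn in zn0 zVn0.
have sum_col k m : \sum_(c <- [seq (k%:Z, j%:Z) | j <- iota 0 m]) cell_value c
    = z^-1 ^+ k * geom z m.
  rewrite big_map geom_iota mulr_sumr; apply: eq_bigr => j _.
  exact: cell_value_nat.
have sum_row k m : \sum_(c <- [seq (i%:Z, k%:Z) | i <- iota 0 m]) cell_value c
    = z ^+ k * geom z^-1 m.
  rewrite big_map geom_iota mulr_sumr; apply: eq_bigr => i _.
  by rewrite mulrC; apply: cell_value_nat.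
(* Multiplied by w, both sums become [geom w m.+2]. With w = z they are T1 and T2, with w = z^-1
   they are T3 and T4. *)
have short (w : F) m : w != 0 -> geom w m.+2 = 0 ->
    w^-1 + geom w m.+1 = 0 /\ w ^+ m + w^-1 * geom w m.+1 = 0.
  move=> w0 gw0; split; apply: (mulfI w0); rewrite mulr0 -gw0.
    by rewrite -(add1n m.+1) geomD /geom big_ord1 mulrDr divff.
  by rewrite [RHS]geomS mulrDr mulVKf // exprS addrC.
case: n n_gt1 zn0 zVn0 => [|[|m]] // _ /eqP zn0 /eqP zVn0.
have [z1 z2] := short z m z_neq0 zn0.
have [] := short z^-1 m (invr_neq0 z_neq0) zVn0; rewrite invrK => w1 w2.
case: T; rewrite /tile_cells big_cons cell_value_nat
  ?(sum_col 0%N, sum_col 1%N, sum_row 0%N, sum_row 1%N).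
- by rewrite mul1r mulr1.
- by rewrite mul1r.
- by rewrite !mul1r.
- by rewrite mulr1.
Qed.

(** Double counting: the sum of the values over the region equals the weighted sum over the tiles,
    each of which contributes 0. *)
Lemma sum_tiling (s : seq (weighted_tile F)) A (r : seq cell) :
    signed_tiling n A s -> uniq r -> r =i A ->
  \sum_(c <- r) cell_value c = 0.
Proof.
move=> sA r_uniq rA.
pose tcells (t : weighted_tile F) :=
  [seq c + tile_shift t | c <- tile_cells n (tile_shape t)].
(* A finite set that contains the region and every tile, on which the two sums can be exchanged. *)
pose U := undup (r ++ flatten (map tcells s)).
have -> : \sum_(c <- r) cell_value c = \sum_(c <- U | c \in A) cell_value c.
  rewrite -[RHS]big_filter; apply: perm_big.
  apply: uniq_perm; rewrite ?filter_uniq ?undup_uniq //.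
  by move=> c; rewrite mem_filter mem_undup mem_cat -rA; case: (c \in r).
rewrite big_mkcond.
under eq_bigr => c _.
  have -> : (if c \in A then cell_value c else 0) =
     \sum_(t <- s) (if covers n t c then tile_weight t * cell_value c else 0).
    by rewrite -big_mkcond -mulr_suml sA; case: ifP; rewrite ?mul1r ?mul0r.
  over.
(* Indexing by positions keeps the fact that the tile belongs to [s], hence that its cells lie in
   [U]. *)
rewrite exchange_big (big_nth (WeightedTile T1 0 0)) big_mkord big1 //= => k _.
set t := nth _ s k.
rewrite -big_mkcond -mulr_sumr -big_filter.
rewrite (perm_big (tcells t)) /=; last first.
  apply: uniq_perm.
  - by rewrite filter_uniq ?undup_uniq.
  - by rewrite map_inj_uniq ?uniq_tile_cells //; apply: addIr.
  move=> c; rewrite mem_filter mem_undup mem_cat.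
  have -> : covers n t c = (c \in tcells t).
    rewrite /covers -mem_tile_cells //.
    rewrite /tcells -[in RHS](subrK (tile_shift t) c).
    by rewrite (mem_map (f := +%R^~ (tile_shift t))) //; apply: addIr.
  case: (boolP (c \in tcells t)) => //= ct.
  apply/orP; right; apply/flattenP; exists (tcells t) => //.
  by rewrite -(nth_map _ [::]) // mem_nth ?size_map.
rewrite big_map; under eq_bigr do rewrite cell_valueD //.
by rewrite -mulr_suml sum_tile_cells mul0r mulr0.
Qed.

End RootOfUnity.

Lemma tileable_rectangle_dvd (F : closedFieldType) n a b p :
    (1 < n)%N -> n%:R != 0 :> F ->
  signed_tileable F n (rectangle p a b) -> (n %| a)%N || (n %| b)%N.
Proof.
move=> n_gt1 /closed_field_prim_root_exists[z z_prim] [s sP].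
pose r : seq cell :=
  [seq (p.1 + i%:Z, p.2 + j%:Z) | i <- iota 0 b, j <- iota 0 a].
have r_uniq : uniq r.
  apply: allpairs_uniq; rewrite ?iota_uniq // => -[i j] [i' j'] _ _ /= [].
  by move=> /addrI[->] /addrI[->].
have mem_r : r =i rectangle p a b.
  move=> c; apply/allpairsP/andP => [[[i j] /= [+ + ->]]|/=].
    by rewrite !mem_iota /= !lerDl !ltrD2l !lez_nat !ltz_nat.
  move=> [c1 c2]; exists (`|c.1 - p.1|%N, `|c.2 - p.2|%N) => /=.
  rewrite !mem_iota; case: c c1 c2 => c1 c2 /= h1 h2.
  by split; [lia | lia | congr (_, _); lia].
have := sum_tiling n_gt1 z_prim sP r_uniq mem_r.
rewrite big_allpairs_dep.
(* The value of the rectangle is a product of a unit and two geometric sums, one of which must then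
   vanish. *)
have -> : \sum_(i <- iota 0 b) \sum_(j <- iota 0 a)
    cell_value z (p.1 + i%:Z, p.2 + j%:Z)
    = cell_value z p * (geom z^-1 b * geom z a).
  rewrite !geom_iota big_distrlr mulr_sumr; apply: eq_bigr => i _.
  rewrite mulr_sumr; apply: eq_bigr => j _ /=.
  by rewrite -(cell_value_nat n_gt1 z_prim) -(cell_valueD n_gt1 z_prim).
move/eqP; rewrite !mulf_eq0 (negPf (cell_value_neq0 n_gt1 z_prim _)) /=.
rewrite (geom_prim_root_eq0 _ n_gt1 z_prim).
by rewrite (geom_prim_root_eq0 _ n_gt1 (prim_rootV z_prim)) orbC.
Qed.

Theorem theorem8 (R : realType) (n : nat) (hn : (5 <= n)%N) (hodd : odd n)
    (a b : nat) (ha : (1 <= a)%N) (hb : (1 <= b)%N) (p : cell) :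
  (signed_tileable rat n (rectangle p a b) <-> ((n %| a) || (n %| b))%N) /\
  (signed_tileable (complex R) n (rectangle p a b) <->
     ((n %| a) || (n %| b))%N).
Proof.
have n_gt1 : (1 < n)%N by apply: leq_trans hn.
have nC : n%:R != 0 :> complex R by rewrite pnatr_eq0 -lt0n ltnW.
split; split; try exact: tileable_rectangle.
  (* Rational weights are read in the algebraically closed field [complex R]. *)
  by move/(tileable_map (@ratr (complex R)))/tileable_rectangle_dvd; apply.
by move/tileable_rectangle_dvd; apply.
Qed.
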